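(* Let $n\ge 3$, let $a_0,\ldots,a_{n-1}$ be indeterminates over $\mathbb{Q}$, $f=x^n+a_{n-1}x^{n-1}+\cdots+a_0$, and \[f_1(x,y)=\frac{f(y)-f(x)}{y-x},\qquad f_3(x,y)=\frac{f(y)-2f\left(\frac{x+y}{2}\right)+f(x)}{\frac{(y-x)^2}{2}},\] $g_1(x,y)=f_1(x-y,x+y)$, $g_3(x,y)=f_3(x-y,x+y)$. Let $D_2\in\mathbb{Q}[a_0,\ldots,a_{n-1}]$ be the polynomial obtained by expressing $\prod_{1\le i,j,k\le n,\ i<j,\ j\ne k,\ k\ne i}(2r_k-r_i-r_j)$ ($r_1,\ldots,r_n$ the roots of $f$) in terms of $a_0,\ldots,a_{n-1}$ via Vieta's formulas. Then, in $\mathbb{Q}[a_0,\ldots,a_{n-1},x,y]$, \[D_2\in\langle f(x),g_1(x,y),g_3(x,y)\rangle\cap\mathbb{Q}[a_0,\ldots,a_{n-1}].\]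
   Context: $\langle g_1,\ldots,g_m\rangle$ is the ideal generated by $g_1,\ldots,g_m$. *)

(* Defs.v *)
From HB Require Import structures.
From mathcomp Require Import all_boot all_order all_algebra.
From mathcomp Require Import mpoly.
Unset Printing Implicit Defensive.
Import GRing.Theory.
Local Open Scope ring_scope.

(* Ambient ring Q[a_0,...,a_{n-1},x,y] = {mpoly rat[n.+2]}:
   variable i (i < n) is a_i, variable n is x, variable n.+1 is y. *)

Definition avar (n : nat) (i : nat) : {mpoly rat[n.+2]} := 'X_(inord i).
Definition xvar (n : nat) : {mpoly rat[n.+2]} := 'X_(inord n).
Definition yvar (n : nat) : {mpoly rat[n.+2]} := 'X_(inord n.+1).

Definition fev (n : nat) (t : {mpoly rat[n.+2]}) : {mpoly rat[n.+2]} :=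
  t ^+ n + \sum_(i < n) avar n i * t ^+ i.

Definition subst_gxy (n : nat) : (n.+2).-tuple {mpoly rat[n.+2]} :=
  [tuple (if val i == n then xvar n - yvar n
          else if val i == n.+1 then xvar n + yvar n
          else 'X_i) | i < n.+2].

Definition is_f1 (n : nat) (f1 : {mpoly rat[n.+2]}) : Prop :=
  (yvar n - xvar n) * f1 = fev n (yvar n) - fev n (xvar n).

Definition is_f3 (n : nat) (f3 : {mpoly rat[n.+2]}) : Prop :=
  ((1 / 2 : rat) *: (yvar n - xvar n) ^+ 2) * f3 =
  fev n (yvar n) - 2%:R * fev n ((1 / 2 : rat) *: (xvar n + yvar n)) + fev n (xvar n).

(* The product over 1<=i,j,k<=n, i<j, j<>k, k<>i of (2 r_k - r_i - r_j),
   in the ring Q[r_1,...,r_n] = {mpoly rat[n]} (0-indexed roots). *)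
Definition D2prod (n : nat) : {mpoly rat[n]} :=
  \prod_(i < n) \prod_(j < n | (i < j)%N) \prod_(k < n | (k != j) && (k != i))
     (2%:R * 'X_k - 'X_i - 'X_j).

(* Vieta: a_i |-> coefficient of x^i in prod (x - r_l), i.e. (-1)^(n-i) e_{n-i}(r) *)
Definition vieta (n : nat) : n.-tuple {mpoly rat[n]} :=
  [tuple ((-1) ^+ (n - i) *: mesym n rat (n - i)) | i < n].

(* D_2 is a polynomial in Q[a_0..a_{n-1}] = {mpoly rat[n]} which, via Vieta's
   formulas, expresses the product above. *)
Definition is_D2 (n : nat) (D : {mpoly rat[n]}) : Prop :=
  D \mPo vieta n = D2prod n.

Definition embed_a (n : nat) (p : {mpoly rat[n]}) : {mpoly rat[n.+2]} :=
  p \mPo [tuple avar n i | i < n].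

Definition in_ideal3 (R : comRingType) (g1 g2 g3 p : R) : Prop :=
  exists c1 c2 c3 : R, p = c1 * g1 + c2 * g2 + c3 * g3.

(* Main.v *)
Require Import Defs.
From HB Require Import structures.
From mathcomp Require Import all_boot all_order all_algebra.
From mathcomp Require Import fingroup perm mpoly.
From mathcomp Require Import ring.
Import GRing.Theory.
Local Open Scope ring_scope.

(** Dividing [f(t)] successively by [t - x], [t - (x + y)] and [t - (x - y)]
    leaves the Newton remainder with coefficients [f(x)], [g1 + y g3] and [g3].
    Hence the ideal [I = <f(x), g1, g3>] is exactly the condition that
    [(t - x) q(t)] divides [f(t)] modulo [I], with
    [q = t^2 - 2 x t + x^2 - y^2].

    Over the ring of the roots, [f = prod_k (t - r_k)].  Modulo [x - r_k] the
    quadratic [q] becomes [t^2 - s t + e] with [s = 2 r_k], and divides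
    [prod_(i != k) (t - r_i)]; it is enough that this forces
    [prod_(i < j) (s - r_i - r_j) = 0], since the product over [k] then lies in
    [I + <prod_k (x - r_k)> = I + <f(x)> = I].  The quadratic claim goes by
    induction: if [q w = (t - c) h] then [q(c) w(c) = 0]; modulo [w(c)] the
    quadratic divides [h], and modulo [q(c)] it is [(t - c) (t - (s - c))], so
    that [h(s - c) = 0].

    Finally the averaging operator over the symmetric group is a
    [Q[a]]-linear retraction of [Q[a]] in [Q[r]], and applying it to the
    cofactors brings the membership down to [Q[a][x, y]]. *)

(** * Ideals as predicates, and divisibility modulo an ideal *)

Section Ideals.
Variable B : comNzRingType.
Implicit Types (I : B -> Prop) (p q w : {poly B}).

Definition is_ideal I : Prop :=
  [/\ I 0, forall a b, I a -> I b -> I (a + b) & forall a b, I b -> I (a * b)].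

(** The ideal [I + <c>]; membership in it stands for reasoning modulo [c] without quotient rings. *)
Definition add_gen I (c : B) : B -> Prop :=
  fun z => exists a b, I a /\ z = a + b * c.

Definition coefs_in I p : Prop := forall i, I p`_i.

Lemma ideal_add_gen I c : is_ideal I -> is_ideal (add_gen I c).
Proof.
case=> I0 ID IM; split.
- by exists 0, 0; rewrite mul0r addr0.
- move=> _ _ [a [b [Ia ->]]] [a' [b' [Ia' ->]]].
  by exists (a + a'), (b + b'); split; [exact: ID | rewrite mulrDl addrACA].
- move=> d _ [a [b [Ia ->]]]; exists (d * a), (d * b).
  by split; [exact: IM | rewrite mulrDr mulrA].
Qed.

Lemma sub_add_gen I c a : I a -> add_gen I c a.
Proof. by exists a, 0; rewrite mul0r addr0. Qed.

Lemma mem_add_gen I c : is_ideal I -> add_gen I c c.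
Proof. by case=> I0 _ _; exists 0, 1; rewrite add0r mul1r. Qed.

Lemma idealB I a b : is_ideal I -> I a -> I b -> I (a - b).
Proof. by case=> _ ID IM Ia Ib; apply: ID => //; rewrite -mulN1r; apply: IM. Qed.

Lemma ideal_sum I (J : Type) (r : seq J) (P : pred J) (F : J -> B) :
  is_ideal I -> (forall j, P j -> I (F j)) -> I (\sum_(j <- r | P j) F j).
Proof. by case=> I0 ID _; apply: big_ind. Qed.

Lemma add_gen_mul I a b c d :
  is_ideal I -> add_gen I c a -> add_gen I d b -> add_gen I (c * d) (a * b).
Proof.
move=> [I0 ID IM] [a1 [a2 [Ia ->]]] [b1 [b2 [Ib ->]]].
exists (b1 * a1 + b2 * d * a1 + a2 * c * b1), (a2 * b2); split; last by ring.
by apply: (ID); [apply: (ID); apply: IM | apply: IM].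
Qed.

Lemma add_gen_mem I a c : is_ideal I -> I c -> add_gen I c a -> I a.
Proof. by move=> [I0 ID IM] Ic [a1 [a2 [Ia ->]]]; apply: ID => //; apply: IM. Qed.

Lemma coefs_inD I p q :
  is_ideal I -> coefs_in I p -> coefs_in I q -> coefs_in I (p + q).
Proof. by case=> _ ID _ Ip Iq i; rewrite coefD; apply: ID. Qed.

Lemma coefs_inM I p q : is_ideal I -> coefs_in I q -> coefs_in I (p * q).
Proof.
move=> idI Iq i; rewrite coefM; apply: ideal_sum => // j _.
by case: idI => _ _ IM; apply: IM.
Qed.

Lemma coefs_inC I c : is_ideal I -> I c -> coefs_in I c%:P.
Proof. by case=> I0 _ _ Ic i; rewrite coefC; case: eqP. Qed.

Lemma coefs_in_sub I c p : coefs_in I p -> coefs_in (add_gen I c) p.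
Proof. by move=> Ip i; apply: sub_add_gen. Qed.

Lemma coefs_in_horner I p c : is_ideal I -> coefs_in I p -> I p.[c].
Proof.
move=> idI Ip; rewrite horner_coef; apply: ideal_sum => // i _.
by rewrite mulrC; case: idI => _ _; apply.
Qed.

(** Coefficient [i.+1] of the product is [p_i - c p_{i+1}], so membership in [I] descends from the
    zero coefficients beyond the degree. *)
Lemma coefs_in_XsubC_cancel I c p :
  is_ideal I -> coefs_in I (('X - c%:P) * p) -> coefs_in I p.
Proof.
move=> idI Ip.
have step i : I p`_i.+1 -> I p`_i.
  move=> Ipi; have := Ip i.+1; rewrite mulrBl coefB coefXM coefCM /= => h.
  case: (idI) => _ ID IM.
  by rewrite -(subrK (c * p`_i.+1) p`_i); apply: ID => //; apply: IM.
have far k i : (size p <= i + k)%N -> I p`_i.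
  elim: k i => [|k IH] i; last by rewrite addnS -addSn => /IH/step.
  by rewrite addn0 => hi; rewrite nth_default //; case: idI.
by move=> i; apply: (far (size p)); rewrite leq_addl.
Qed.

Lemma poly_XsubC_divE p c : exists w, p = ('X - c%:P) * w + p.[c]%:P.
Proof.
have : root (p - p.[c]%:P) c by rewrite rootE !hornerE subrr.
by case/factor_theorem=> w hw; exists w; rewrite mulrC -hw subrK.
Qed.

(* Comparing coefficients of degree at least 2 forces [w] into [I], from the top
   down. *)
Lemma monic_quadratic_dvd1 I (s e : B) w :
  is_ideal I -> coefs_in I (1 - ('X^2 - s *: 'X + e%:P) * w) -> I 1.
Proof.
move=> idI Iw; have [I0 ID IM] := idI.
have step i : I w`_i.+1 -> I w`_i.+2 -> I w`_i.
  move=> h1 h2; have := Iw i.+2; rewrite coefB coef1 /= sub0r.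
  rewrite mulrDl mulrBl -scalerAl !coefD coefN coefZ coefXM coefXnM coefCM /=.
  rewrite subn2 /= => h.
  have -> : w`_i = (s * w`_i.+1 - e * w`_i.+2)
      - - (w`_i - s * w`_i.+1 + e * w`_i.+2) by ring.
  by apply: idealB => //; apply: idealB => //; apply: IM.
have far k i : (size w <= i + k)%N -> I w`_i /\ I w`_i.+1.
  elim: k i => [|k IH] i.
    by rewrite addn0 => hi; rewrite !nth_default //; apply: leqW.
  by rewrite addnS -addSn => /IH[h1 h2]; split=> //; apply: step.
have Iw0 : coefs_in I w by move=> i; case: (far (size w) i (leq_addl _ _)).
have I1 := coefs_inM I ('X^2 - s *: 'X + e%:P) w idI Iw0.
have := ID _ _ (Iw 0%N) (I1 0%N).
by rewrite coefB coef1 subrK.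
Qed.

(** Induction on [l] with [I] and [w] varying, since both branches of the step work modulo a larger
    ideal. An arbitrary ordered list allows an index to be left out later. *)
Lemma pair_sum_prod_in_ideal (J : Type) (lt : rel J) (r : J -> B) (s e : B)
    (l : seq J) I w :
  irreflexive lt -> (forall i j, lt i j -> lt j i = false) ->
  is_ideal I -> pairwise lt l ->
  coefs_in I (\prod_(i <- l) ('X - (r i)%:P) - ('X^2 - s *: 'X + e%:P) * w) ->
  I (\prod_(i <- l) \prod_(j <- l | lt i j) (s - r i - r j)).
Proof.
move=> irr asym; elim: l I w => [|i0 l IH] I w idI /=.
  by move=> _; rewrite !big_nil; apply: monic_quadratic_dvd1.
case/andP=> i0l pl; rewrite !big_cons irr.
set h := \prod_(i <- l) _; set c := r i0; set q := _ + e%:P => Ihqw.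
(* The head precedes every index of [l], so its pairs give all the factors of [h] at [s - c]. *)
have -> : \prod_(j <- l | lt i0 j) (s - c - r j) = h.[s - c].
  rewrite horner_prod big_mkcond /=; elim: l i0l {pl IH h Ihqw} => [|j l IHl] /=.
    by rewrite !big_nil.
  by case/andP=> ij /IHl; rewrite !big_cons ij => ->; rewrite !hornerE.
have -> : \prod_(i <- l) \prod_(j <- i0 :: l | lt i j) (s - r i - r j)
    = \prod_(i <- l) \prod_(j <- l | lt i j) (s - r i - r j).
  have : all (fun i => ~~ lt i i0) l.
    by apply: sub_all i0l => i /asym ->.
  elim: {1 2 4}l => [|i l' IHl] /=; first by rewrite !big_nil.
  case/andP=> ni /IHl {}IHl; rewrite !big_cons (negbTE ni).
  by congr (_ * _).
have [w' wE] := poly_XsubC_divE w c.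
(* The roots of [q] sum to [s], so modulo [q(c)] the second root is [s - c]. *)
have qE : q = ('X - c%:P) * ('X - (s - c)%:P) + q.[c]%:P.
  rewrite /q !hornerE /= -mul_polyC !rmorphD !rmorphN /= !rmorphM /=.
  by ring.
(* Evaluating the hypothesis at [c] gives [q(c) w(c)] in [I]. It remains to put the head factor in
   [I + <q(c)>] and the other pairs in [I + <w(c)>]. *)
apply: (add_gen_mem _ _ (q.[c] * w.[c])) => //.
  have := coefs_in_horner _ _ c idI Ihqw.
  rewrite !hornerE subrr mul0r sub0r => h1.
  by rewrite -[_ * _]opprK -mulN1r; case: idI => _ _; apply.
apply: add_gen_mul => //.
  have idI' := ideal_add_gen I q.[c] idI.
  have : coefs_in (add_gen I q.[c]) (h - ('X - (s - c)%:P) * w).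
    apply: (coefs_in_XsubC_cancel _ c) => //.
    have -> : ('X - c%:P) * (h - ('X - (s - c)%:P) * w)
        = (('X - c%:P) * h - q * w) + w * q.[c]%:P.
      by rewrite {1}qE; ring.
    apply: coefs_inD => //; first exact: coefs_in_sub.
    by apply: coefs_inM => //; apply: coefs_inC => //; apply: mem_add_gen.
  move/(coefs_in_horner _ _ (s - c) idI').
  by rewrite !hornerE subrr mul0r subr0.
have idI' := ideal_add_gen I w.[c] idI.
apply: (IH _ w') => //.
apply: (coefs_in_XsubC_cancel _ c) => //.
have -> : ('X - c%:P) * (h - q * w')
    = (('X - c%:P) * h - q * w) + q * w.[c]%:P.
  by rewrite {1}wE; ring.
apply: coefs_inD => //; first exact: coefs_in_sub.
by apply: coefs_inM => //; apply: coefs_inC => //; apply: mem_add_gen.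
Qed.

Lemma triple_prod_in_ideal n (r : 'I_n -> B) (x e : B) I w :
  is_ideal I -> I (\prod_i (x - r i)) ->
  coefs_in I (\prod_i ('X - (r i)%:P)
    - ('X - x%:P) * (('X^2 - (2%:R * x) *: 'X + e%:P) * w)) ->
  I (\prod_(i < n) \prod_(j < n | (i < j)%N)
      \prod_(k < n | (k != j) && (k != i)) (2%:R * r k - r i - r j)).
Proof.
move=> idI Ifx Idiv.
(* [G k] collects the factors with a fixed [k], to which the quadratic claim applies. *)
pose G k := \prod_(i < n | i != k) \prod_(j < n | (j != k) && (i < j)%N)
  (2%:R * r k - r i - r j).
have -> : \prod_(i < n) \prod_(j < n | (i < j)%N)
    \prod_(k < n | (k != j) && (k != i)) (2%:R * r k - r i - r j)
    = \prod_k G k.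
  rewrite /G [RHS](exchange_big_dep predT) //=; apply: eq_bigr => i _.
  rewrite [RHS](exchange_big_dep (fun j : 'I_n => (i < j)%N)) /=; last first.
    by move=> k j _ /andP[].
  apply: eq_bigr => j ij; apply: eq_bigl => k.
  by rewrite ij andbT andbC eq_sym (eq_sym k j).
suff IG k : add_gen I (x - r k) (G k).
  apply: (add_gen_mem _ _ _ idI Ifx).
  elim/big_ind2: _ => //; last by move=> a b c d; apply: add_gen_mul.
  by exists 0, 1; case: idI => I0 _ _; split=> //; rewrite mulr1 add0r.
have idIk := ideal_add_gen I (x - r k) idI.
pose l := [seq i <- enum 'I_n | i != k].
have big_l (R : Type) (idx : R) (op : Monoid.com_law idx) (P : pred 'I_n) F :
    \big[op/idx]_(i <- l | P i) F i = \big[op/idx]_(i < n | (i != k) && P i) F i.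
  by rewrite big_filter_cond big_enum_cond.
have -> : G k = \prod_(i <- l) \prod_(j <- l | (i < j)%N)
    (2%:R * r k - r i - r j).
  rewrite big_l; apply: eq_big => [i|i _]; first by rewrite andbT.
  by rewrite big_l.
apply: (pair_sum_prod_in_ideal _ (fun i j : 'I_n => (i < j)%N) r _ e _ _ w) => //.
- by move=> i j ij; apply/negbTE; rewrite -leqNgt ltnW.
- apply: pairwise_filter; rewrite -(pairwise_map val ltn) val_enum_ord.
  by rewrite -sorted_pairwise ?iota_ltn_sorted //; apply: ltn_trans.
apply: (coefs_in_XsubC_cancel _ (r k)) => //.
set q := _ + e%:P in Idiv; set h := \prod_(i <- l) _.
have hE : \prod_i ('X - (r i)%:P) = ('X - (r k)%:P) * h.
  rewrite (bigD1 k) //= /h big_l; congr (_ * _).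
  by apply: eq_bigl => i; rewrite andbT.
(* Replacing [x] by [r k] in the cubic divisor costs an explicit multiple of [x - r k]. *)
have -> : ('X - (r k)%:P) * (h - ('X^2 - (2%:R * r k) *: 'X + e%:P) * w)
    = (\prod_i ('X - (r i)%:P) - ('X - x%:P) * (q * w))
    + (- (q * w) - 2%:R * 'X * ('X - (r k)%:P) * w) * (x - r k)%:P.
  by rewrite hE /q -!mul_polyC !rmorphM !rmorphB /= !rmorph_nat; ring.
apply: coefs_inD => //; first exact: coefs_in_sub.
by apply: coefs_inM => //; apply: coefs_inC => //; apply: mem_add_gen.
Qed.

End Ideals.

(** * The Vieta substitution and averaging over the symmetric group *)

Lemma comp_mpolyA (R : comNzRingType) k m l (p : {mpoly R[k]})
    (u : k.-tuple {mpoly R[m]}) (v : m.-tuple {mpoly R[l]}) :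
  p \mPo u \mPo v = p \mPo [tuple tnth u i \mPo v | i < k].
Proof.
rewrite (comp_mpolyE p u) [RHS]comp_mpolyE raddf_sum /=; apply: eq_bigr => i _.
rewrite comp_mpolyZ rmorph_prod; congr (_ *: _); apply: eq_bigr => j _.
by rewrite rmorphXn tnth_mktuple.
Qed.

Section Reynolds.
Variable n : nat.
Local Notation A := {mpoly rat[n]}.
Implicit Types (p q t : A).

(* If [e] is the tuple of the elementary symmetric polynomials of degrees 1 to
   [n], then [vieta n] is [revieta] evaluated at [e]; [unvieta] is the inverse
   substitution. *)
Definition unvieta : n.-tuple A :=
  [tuple (-1) ^+ (i.+1) *: 'X_(rev_ord i) | i < n].

Definition revieta : n.-tuple A :=
  [tuple (-1) ^+ (n - i) *: 'X_(rev_ord i) | i < n].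

Local Notation S := [tuple mesym n rat i.+1 | i < n].

Lemma comp_unvieta t : t \mPo unvieta \mPo vieta n = t \mPo S.
Proof.
rewrite comp_mpolyA; congr (_ \mPo _); apply: eq_from_tnth => i.
rewrite !tnth_mktuple comp_mpolyZ comp_mpolyXU -tnth_nth tnth_mktuple /=.
have -> : (n - (n - i.+1))%N = i.+1 by rewrite subKn.
by rewrite scalerA -expr2 sqrr_sign scale1r.
Qed.

Lemma comp_vieta t : t \mPo vieta n = t \mPo revieta \mPo S.
Proof.
rewrite comp_mpolyA; congr (_ \mPo _); apply: eq_from_tnth => i.
rewrite !tnth_mktuple comp_mpolyZ comp_mpolyXU -tnth_nth tnth_mktuple /=.
by rewrite subnSK.
Qed.

Lemma revietaK t : t \mPo revieta \mPo unvieta = t.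
Proof.
rewrite comp_mpolyA -[RHS]comp_mpoly_id; congr (_ \mPo _).
apply: eq_from_tnth => i.
rewrite !tnth_mktuple comp_mpolyZ comp_mpolyXU -tnth_nth tnth_mktuple /=.
by rewrite subnSK // scalerA -expr2 sqrr_sign scale1r rev_ordK.
Qed.

(** Up to signs and reversal of the variables this is the algebraic independence of the elementary
    symmetric polynomials. Identities in the [a_i] can thus be checked on the roots. *)
Lemma comp_vieta_inj : injective (comp_mpoly (vieta n)).
Proof.
move=> p q; rewrite !comp_vieta => /msym_fundamental_un h.
by rewrite -(revietaK p) h revietaK.
Qed.

Definition symmetrize p : A := (n`!%:R)^-1 *: \sum_(s : 'S_n) msym s p.

Lemma symmetrize_sym p : symmetrize p \is symmetric.
Proof.
apply/issymP => s; rewrite /symmetrize msymZ; congr (_ *: _).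
rewrite raddf_sum [RHS](reindex_inj (mulIg s)) /=.
by apply: eq_bigr => s' _; rewrite msymMm.
Qed.

Lemma symmetrizeM p q : p \is symmetric -> symmetrize (p * q) = p * symmetrize q.
Proof.
move=> /issymP symp; rewrite /symmetrize -scalerAr mulr_sumr.
by congr (_ *: _); apply: eq_bigr => s _; rewrite msymM symp.
Qed.

Lemma symmetrize1 : symmetrize 1 = 1.
Proof.
rewrite /symmetrize (eq_bigr (fun=> 1)) => [|s _]; last exact: msym1.
rewrite sumr_const card_Sn -scaler_nat scalerA mulVf ?scale1r //.
by rewrite Num.Theory.pnatr_eq0 -lt0n fact_gt0.
Qed.

(** The average of [p] over permutations of the roots, rewritten as a polynomial in the [a_i]. *)
Definition reynolds p : A :=
  sval (sym_fundamental (symmetrize_sym p)) \mPo unvieta.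

Lemma comp_reynolds p : reynolds p \mPo vieta n = symmetrize p.
Proof.
by rewrite /reynolds comp_unvieta; case: (sym_fundamental _) => t [].
Qed.

Lemma reynolds_is_zmod_morphism : zmod_morphism reynolds.
Proof.
move=> p q; apply: comp_vieta_inj; rewrite comp_mpolyB !comp_reynolds.
rewrite /symmetrize -scalerBr -sumrB.
by congr (_ *: _); apply: eq_bigr => s _; rewrite msymB.
Qed.

HB.instance Definition _ :=
  GRing.isZmodMorphism.Build A A reynolds reynolds_is_zmod_morphism.

Lemma comp_vieta_symmetric p : p \mPo vieta n \is symmetric.
Proof.
apply: mcomp_sym => i; rewrite -tnth_nth tnth_mktuple.
by apply/rpredZ/mesym_sym.
Qed.

Lemma reynoldsM p q : reynolds ((p \mPo vieta n) * q) = p * reynolds q.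
Proof.
apply: comp_vieta_inj.
by rewrite rmorphM /= !comp_reynolds symmetrizeM // comp_vieta_symmetric.
Qed.

Lemma reynolds1 : reynolds 1 = 1.
Proof. by apply: comp_vieta_inj; rewrite comp_reynolds comp_mpoly1 symmetrize1. Qed.

End Reynolds.

(** * The generic monic polynomial and its roots *)

Section Vieta.
Variable n : nat.
Local Notation A := {mpoly rat[n]}.

Definition generic_poly : {poly A} := 'X^n + \sum_(i < n) ('X_i)%:P * 'X^i.

Lemma map_mesym k : map_mpoly intr (mesym n int k) = mesym n rat k.
Proof.
rewrite /mesym raddf_sum /=; apply: eq_bigr => h _.
by rewrite rmorph_prod /=; apply: eq_bigr => i _; rewrite map_mpolyX.
Qed.

Lemma generic_poly_vieta :
  map_poly (comp_mpoly (vieta n)) generic_poly = \prod_(i < n) ('X - ('X_i)%:P).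
Proof.
(* Vieta's formulas over the integers are carried to the rationals. *)
have := congr1 (map_poly (map_mpoly (intr : int -> rat))) (Viete n).
rewrite rmorph_prod (eq_bigr (fun i => 'X - ('X_i : A)%:P)) => [->|i _]; last first.
  by rewrite rmorphB /= map_polyX map_polyC /= map_mpolyX.
rewrite rmorphD /= map_polyXn !rmorph_sum big_ord_recl /=.
rewrite expr0 scale1r subn0 mesym0E scale1r map_polyXn; congr (_ + _).
rewrite (reindex_inj rev_ord_inj); apply: eq_bigr => i _.
rewrite rmorphM /= map_polyXn map_polyC /= comp_mpolyXU -tnth_nth tnth_mktuple.
rewrite /bump /= add1n subKn // !map_polyZ /= map_polyXn.
rewrite map_mesym rmorphXn rmorphN1 -!mul_polyC mulrA -rmorphM; congr (_%:P * _).
by rewrite -mul_mpolyC rmorphXn rmorphN1.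
Qed.

End Vieta.

(** * Newton division at three nodes *)

Lemma in_ideal3_ideal (B : comNzRingType) (d0 d1 d2 : B) :
  is_ideal B (in_ideal3 B d0 d1 d2).
Proof.
split.
- by exists 0, 0, 0; rewrite !mul0r !addr0.
- move=> _ _ [a [b [c ->]]] [a' [b' [c' ->]]].
  by exists (a + a'), (b + b'), (c + c'); ring.
- move=> u _ [a [b [c ->]]].
  by exists (u * a), (u * b), (u * c); ring.
Qed.

(** Newton interpolation at the nodes [x], [x + y], [x - y], with quotient [w]. The last two nodes
    together give the quadratic [t^2 - 2 x t + x^2 - y^2]. *)
Definition newton_form {B : comNzRingType} (x y d0 d1 d2 : B) (w : {poly B}) :=
  ('X - x%:P) * (('X - (x + y)%:P) * ('X - (x - y)%:P) * w)
    + d2%:P * (('X - x%:P) * ('X - (x + y)%:P)) + d1%:P * ('X - x%:P) + d0%:P.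

Lemma newton_division (B : comNzRingType) (F : {poly B}) (x y : B) :
  exists d1 d2 w, F = newton_form x y F.[x] d1 d2 w.
Proof.
have [w1 F1] := poly_XsubC_divE _ F x.
have [w2 w1E] := poly_XsubC_divE _ w1 (x + y).
have [w3 w2E] := poly_XsubC_divE _ w2 (x - y).
exists w1.[x + y], w2.[x - y], w3; rewrite /newton_form.
by rewrite {1}F1 {1}w1E {1}w2E; ring.
Qed.

(** The product defining [D_2], for roots in any ring, so that it can be moved along morphisms. *)
Definition triple_prod {B : comNzRingType} {n : nat} (r : 'I_n -> B) : B :=
  \prod_(i < n) \prod_(j < n | (i < j)%N)
    \prod_(k < n | (k != j) && (k != i)) (2%:R * r k - r i - r j).

Lemma rmorph_triple_prod (B C : comNzRingType) (f : {rmorphism B -> C}) n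
    (r : 'I_n -> B) : f (triple_prod r) = triple_prod (f \o r).
Proof.
rewrite rmorph_prod; apply: eq_bigr => i _.
rewrite rmorph_prod; apply: eq_bigr => j _.
rewrite rmorph_prod; apply: eq_bigr => k _.
by rewrite !rmorphB rmorphM rmorph_nat.
Qed.

Lemma map_newton_form (B C : comNzRingType) (f : {rmorphism B -> C})
    (x y d0 d1 d2 : B) (w : {poly B}) :
  map_poly f (newton_form x y d0 d1 d2 w)
  = newton_form (f x) (f y) (f d0) (f d1) (f d2) (map_poly f w).
Proof.
rewrite /newton_form !(rmorphD, rmorphM, rmorphN) /=.
by rewrite !(map_polyC, map_polyX) ?rmorphN.
Qed.

Lemma triple_prod_in_newton_ideal (B : comNzRingType) n (r : 'I_n -> B)
    (x y d0 d1 d2 : B) (w : {poly B}) :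
  \prod_i ('X - (r i)%:P) = newton_form x y d0 d1 d2 w ->
  in_ideal3 B d0 d1 d2 (triple_prod r).
Proof.
move=> hdiv; set I := in_ideal3 B d0 d1 d2.
have idI : is_ideal _ I := in_ideal3_ideal _ _ _ _.
have [I0 I1 I2] : [/\ I d0, I d1 & I d2].
  split; [exists 1, 0, 0 | exists 0, 1, 0 | exists 0, 0, 1];
  by rewrite !mul0r ?addr0 ?add0r mul1r.
apply: (triple_prod_in_ideal _ _ r x (x ^+ 2 - y ^+ 2) I w) => //.
  have -> : \prod_i (x - r i) = (\prod_i ('X - (r i)%:P)).[x].
    by rewrite horner_prod; apply: eq_bigr => i _; rewrite !hornerE.
  by rewrite hdiv /newton_form !hornerE subrr /= !(mul0r, mulr0, add0r).
rewrite hdiv /newton_form.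
set e := (X in coefs_in _ _ X).
have -> : e = ('X - x%:P) * ('X - (x + y)%:P) * d2%:P
    + ('X - x%:P) * d1%:P + 1 * d0%:P.
  rewrite /e -!mul_polyC !rmorphM rmorph_nat !rmorphB !rmorphXn !rmorphD /=.
  by ring.
by do 2?[apply: coefs_inD => //]; apply: coefs_inM => //; apply: coefs_inC.
Qed.

(** * Descent of ideal membership along a linear retraction *)

Section Retraction.
Variables (R A : comNzRingType) (phi : {rmorphism R -> A}) (rho : {additive A -> R}).
Hypothesis rhoM : forall a b, rho (phi a * b) = a * rho b.

Lemma map_poly_retraction (a : {poly R}) (b : {poly A}) :
  map_poly rho (map_poly phi a * b) = a * map_poly rho b.
Proof.
apply/polyP => i; rewrite coef_map !coefM raddf_sum; apply: eq_bigr => j _.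
by rewrite coef_map /= rhoM coef_map.
Qed.

Lemma in_ideal3_retraction (g1 g2 g3 p : R) : rho 1 = 1 ->
  in_ideal3 A (phi g1) (phi g2) (phi g3) (phi p) -> in_ideal3 R g1 g2 g3 p.
Proof.
move=> rho1 [c1 [c2 [c3 hp]]]; exists (rho c1), (rho c2), (rho c3).
(* [p = p * rho 1 = rho (phi p)], and [rho] then acts on the cofactors only. *)
rewrite -[LHS]mulr1 -rho1 -rhoM mulr1 hp !raddfD /=.
by rewrite !(mulrC _ (phi _)) !rhoM !(mulrC _ (rho _)).
Qed.

End Retraction.

Section Descent.
Variables (R A : comNzRingType) (phi : {rmorphism R -> A}) (rho : {additive A -> R}).
Hypothesis rhoM : forall a b, rho (phi a * b) = a * rho b.
Hypothesis rho1 : rho 1 = 1.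
Variables (n : nat) (F : {poly R}) (r : 'I_n -> A) (D : R).
Hypothesis phiF : map_poly phi F = \prod_i ('X - (r i)%:P).
Hypothesis phiD : phi D = triple_prod r.

(** Two polynomial layers adjoin the indeterminates [x] and [y]; [phi] and [rho] extend to them
    coefficientwise, and [rho] stays a linear retraction. *)
Lemma descended_in_newton_ideal (x y d0 d1 d2 : {poly {poly R}}) w :
  map_poly (polyC \o polyC) F = newton_form x y d0 d1 d2 w ->
  in_ideal3 _ d0 d1 d2 D%:P%:P.
Proof.
move=> hdiv.
pose phi2 : {rmorphism {poly {poly R}} -> {poly {poly A}}} :=
  map_poly (map_poly phi).
pose rho2 : {additive {poly {poly A}} -> {poly {poly R}}} :=
  map_poly (map_poly rho).
have phi2C a : phi2 a%:P%:P = (phi a)%:P%:P.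
  by rewrite /phi2 /= map_polyC /= map_polyC.
apply: (in_ideal3_retraction _ _ phi2 rho2).
- move=> a b; apply: map_poly_retraction => {}a {}b.
  exact: map_poly_retraction.
- rewrite /rho2 /= -(rmorph1 polyC) map_polyC /=.
  by rewrite -(rmorph1 polyC) map_polyC /= rho1.
pose C : {rmorphism A -> {poly {poly A}}} := polyC \o polyC.
rewrite phi2C phiD [X in in_ideal3 _ _ _ _ X](rmorph_triple_prod _ _ C).
apply: (triple_prod_in_newton_ideal _ _ _ (phi2 x) (phi2 y) _ _ _ (map_poly phi2 w)).
rewrite -map_newton_form -hdiv.
transitivity (map_poly C (map_poly phi F)).
  rewrite phiF rmorph_prod; apply: eq_bigr => i _.
  by rewrite rmorphB /= map_polyX map_polyC.
by rewrite -!map_poly_comp; apply: eq_map_poly => a; rewrite /= -phi2C.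
Qed.

End Descent.

Lemma D2_in_newton_ideal n (D : {mpoly rat[n]}) x y d0 d1 d2 w :
  is_D2 n D ->
  map_poly (polyC \o polyC) (generic_poly n) = newton_form x y d0 d1 d2 w ->
  in_ideal3 {poly {poly {mpoly rat[n]}}} d0 d1 d2 D%:P%:P.
Proof.
move=> hD.
pose phi : {rmorphism {mpoly rat[n]} -> {mpoly rat[n]}} := comp_mpoly (vieta n).
pose rho : {additive {mpoly rat[n]} -> {mpoly rat[n]}} := reynolds n.
have rhoM a b : rho (phi a * b) = a * rho b by apply: reynoldsM.
have rho1 : rho 1 = 1 by apply: reynolds1.
pose r (i : 'I_n) : {mpoly rat[n]} := 'X_i.
have phiF : map_poly phi (generic_poly n) = \prod_i ('X - (r i)%:P).
  exact: generic_poly_vieta.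
have phiD : phi D = triple_prod r by apply: hD.
move: phi rho r rhoM rho1 phiF phiD => phi rho r rhoM rho1 phiF phiD.
exact: (descended_in_newton_ideal _ _ _ _ rhoM rho1 _ _ _ _ phiF phiD).
Qed.

(** * Return to the multivariate ring, and the conclusion *)

Lemma horner2_morphism (R M : comNzRingType) (f : {rmorphism R -> M}) (x y : M) :
  exists chi : {rmorphism {poly {poly R}} -> M},
    [/\ chi 'X%:P = x, chi 'X = y & forall a, chi a%:P%:P = f a].
Proof.
pose chi : {rmorphism {poly {poly R}} -> M} :=
  horner_eval y \o map_poly (horner_eval x \o map_poly f).
exists chi; split=> [||a]; rewrite /chi /= horner_evalE.
- by rewrite map_polyC /= horner_evalE map_polyX !hornerE.
- by rewrite map_polyX hornerX.
- by rewrite map_polyC /= horner_evalE map_polyC !hornerE.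
Qed.

(** The values at [x + y] and [x - y] are [d0 + y d1] and [d0 - y d1 + 2 y^2 d2]; their sum and
    difference determine [d2] and [d1] after cancelling [2 y] and [y]. *)
Lemma newton_form_coefs (M : idomainType) (x y d0 d1 d2 g1 g3 : M) (w : {poly M}) :
  let F := newton_form x y d0 d1 d2 w in
  2%:R * y != 0 ->
  2%:R * y * g1 = F.[x + y] - F.[x - y] ->
  2%:R * y * (y * g3) = F.[x + y] - 2%:R * F.[x] + F.[x - y] ->
  [/\ d0 = F.[x], d1 = g1 + y * g3 & d2 = g3].
Proof.
move=> F y2 hg1 hg3.
have Fx : F.[x] = d0.
  by rewrite /F /newton_form !hornerE /= subrr; ring.
have Fp : F.[x + y] = d0 + y * d1.
  by rewrite /F /newton_form !hornerE /=; ring.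
have Fm : F.[x - y] = d0 - y * d1 + 2%:R * y * (y * d2).
  by rewrite /F /newton_form !hornerE /=; ring.
have y0 : y != 0 by apply: contraNneq y2 => ->; rewrite mulr0.
have d2E : d2 = g3.
  apply: (mulfI y0); apply: (mulfI y2); rewrite hg3 Fx Fp Fm; ring.
split=> //; apply: (mulfI y2); rewrite mulrDr hg1 Fp Fm -d2E; ring.
Qed.

Lemma fev_generic n t :
  fev n t = (map_poly (comp_mpoly [tuple avar n i | i < n]) (generic_poly n)).[t].
Proof.
rewrite /generic_poly rmorphD /= map_polyXn rmorph_sum hornerD hornerXn.
rewrite horner_sum; congr (_ + _); apply: eq_bigr => i _.
rewrite rmorphM /= map_polyC map_polyXn !hornerE /=.
by rewrite comp_mpolyXU -tnth_nth tnth_mktuple.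
Qed.

Lemma avar_subst n (i : 'I_n) : avar n i \mPo subst_gxy n = avar n i.
Proof.
have hi : (i < n.+1)%N := leqW (ltn_ord i).
rewrite comp_mpolyXU -tnth_nth tnth_mktuple /= inordK ?(leqW hi) //.
by rewrite (ltn_eqF (ltn_ord i)) (ltn_eqF hi).
Qed.

Lemma xvar_subst n : xvar n \mPo subst_gxy n = xvar n - yvar n.
Proof. by rewrite comp_mpolyXU -tnth_nth tnth_mktuple /= inordK // eqxx. Qed.

Lemma yvar_subst n : yvar n \mPo subst_gxy n = xvar n + yvar n.
Proof.
by rewrite comp_mpolyXU -tnth_nth tnth_mktuple /= inordK // eqxx gtn_eqF.
Qed.

Lemma fev_subst n t : fev n t \mPo subst_gxy n = fev n (t \mPo subst_gxy n).
Proof.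
rewrite /fev rmorphD /= rmorphXn rmorph_sum; congr (_ + _).
by apply: eq_bigr => i _; rewrite rmorphM rmorphXn /= avar_subst.
Qed.

Lemma subst_f1 n (f1 : {mpoly rat[n.+2]}) : is_f1 n f1 ->
  2%:R * yvar n * (f1 \mPo subst_gxy n)
  = fev n (xvar n + yvar n) - fev n (xvar n - yvar n).
Proof.
move=> /(congr1 (comp_mpoly (subst_gxy n))).
rewrite rmorphM !rmorphB /= !fev_subst xvar_subst yvar_subst => <-.
by ring.
Qed.

(** Under the substitution the midpoint becomes [x] and the denominator becomes
    [(2 y)^2 / 2 = 2 y^2]. *)
Lemma subst_f3 n (f3 : {mpoly rat[n.+2]}) : is_f3 n f3 ->
  2%:R * yvar n * (yvar n * (f3 \mPo subst_gxy n))
  = fev n (xvar n + yvar n) - 2%:R * fev n (xvar n) + fev n (xvar n - yvar n).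
Proof.
move=> /(congr1 (comp_mpoly (subst_gxy n))).
have half (p : {mpoly rat[n.+2]}) : (1 / 2 : rat) *: (2%:R * p) = p.
  by rewrite mulr_natl -scaler_nat scalerA mul1r mulVf ?scale1r.
rewrite rmorphM /= comp_mpolyZ rmorphXn /= (comp_mpolyD _ (fev n _ - _)).
rewrite (comp_mpolyB _ (fev n _)) (comp_mpolyB _ (yvar n)) rmorphM rmorph_nat /=.
rewrite !fev_subst comp_mpolyZ rmorphD /= xvar_subst yvar_subst.
have -> : (xvar n - yvar n + (xvar n + yvar n)) = 2%:R * xvar n by ring.
rewrite half => <-; rewrite -[in RHS]scalerAl.
rewrite -[LHS]half.
by congr (_ *: _); ring.
Qed.

Theorem corollary1 (n : nat) (hn : (3 <= n)%N)
  (f1 f3 : {mpoly rat[n.+2]}) (D2 : {mpoly rat[n]}) :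
  is_f1 n f1 -> is_f3 n f3 -> is_D2 n D2 ->
  in_ideal3 _ (fev n (xvar n)) (f1 \mPo subst_gxy n) (f3 \mPo subst_gxy n)
            (embed_a n D2).
Proof.
move=> /subst_f1 hg1 /subst_f3 hg3 hD.
set g1 := f1 \mPo _ in hg1 *; set g3 := f3 \mPo _ in hg3 *.
set x := xvar n in hg1 hg3 *; set y := yvar n in hg1 hg3 *.
pose emb : {rmorphism {mpoly rat[n]} -> {mpoly rat[n.+2]}} :=
  comp_mpoly [tuple avar n i | i < n].
have y2 : 2%:R * y != 0.
  by rewrite mulr_natl -scaler_nat scaler_eq0 negb_or /= -msupp_eq0 msuppX.
have [chi [chix chiy chiC]] := horner2_morphism _ _ emb x y.
pose F : {poly {poly {poly {mpoly rat[n]}}}} :=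
  map_poly (polyC \o polyC) (generic_poly n).
(* The division takes place in [Q[a][x][y]], with [x] the inner and [y] the outer variable; [chi]
   carries the result to the ambient ring. *)
have [d1 [d2 [w hF]]] := newton_division _ F 'X%:P 'X.
have [c1 [c2 [c3 hc]]] := D2_in_newton_ideal _ _ _ _ _ _ _ _ hD hF.
have chiF : map_poly chi F =
    newton_form x y (chi F.['X%:P]) (chi d1) (chi d2) (map_poly chi w).
  by rewrite {1}hF map_newton_form chix chiy.
have fevE t : fev n t = (map_poly chi F).[t].
  rewrite fev_generic /F -map_poly_comp; congr (_.[_]).
  by apply: eq_map_poly => a; rewrite /= chiC.
have [d0E d1E d2E] :
    [/\ chi F.['X%:P] = fev n x, chi d1 = g1 + y * g3 & chi d2 = g3].
  by rewrite fevE chiF; apply: newton_form_coefs => //; rewrite -chiF -!fevE.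
have := congr1 chi hc; rewrite chiC !rmorphD !rmorphM d0E d1E d2E.
rewrite -[embed_a n D2]/(emb D2) => ->.
(* From [c2 (g1 + y g3) + c3 g3 = c2 g1 + (c2 y + c3) g3]. *)
by exists (chi c1), (chi c2), (chi c2 * y + chi c3);
rewrite (mulrDr (chi c2)) (mulrDl (chi c2 * y)) mulrA !addrA.
Qed.
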